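(* Let $f$ be a (left slice) regular function on a circular s-domain $\Omega\subseteq\mathbb{H}$. Choose any $J\in\mathbb{S}$. Then the following equality holds for all $q=x+yI\in\Omega$ ($x,y\in\mathbb{R}$, $I\in\mathbb{S}$): $$f(x+yI)=\frac12\Big[f(x+yJ)+f(x-yJ)\Big]+I\,\frac12\Big[J\big[f(x-yJ)-f(x+yJ)\big]\Big].$$
   Context: $\mathbb{H}$ is the real algebra of quaternions; $\mathbb{S}=\{q\in\mathbb{H}: \mathrm{Re}(q)=0,\ |q|=1\}$ is the 2-sphere of imaginary units. For $I\in\mathbb{S}$, $L_I=\mathbb{R}+I\mathbb{R}$. A function $f:U\to\mathbb{H}$ on an open set $U\subseteq\mathbb{H}$ is (left slice) regular if for every $I\in\mathbb{S}$ the restriction $f_I$ of $f$ to $U\cap L_I$ is real differentiable and $\frac12\left(\frac{\partial}{\partial x}+I\frac{\partial}{\partial y}\right)f_I(x+yI)=0$. A domain is a nonempty connected open set. A domain $\Omega\subseteq\mathbb{H}$ is a slice domain (s-domain) if $\Omega\cap\mathbb{R}\neq\emptyset$ and $\Omega\cap L_I$ is a domain in $L_I$ for all $I\in\mathbb{S}$. A set $\Omega\subseteq\mathbb{H}$ is circular if $x+yI\in\Omega$ (with $x,y\in\mathbb{R}$, $I\in\mathbb{S}$) implies $x+y\mathbb{S}=\{x+yJ: J\in\mathbb{S}\}\subseteq\Omega$. *)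

(* Defs.v *)
From HB Require Import structures.
From mathcomp Require Import all_boot all_order all_algebra.
From mathcomp Require Import ring lra.
From mathcomp Require Import all_classical all_reals all_analysis.

Set Implicit Arguments.
Unset Strict Implicit.
Unset Printing Implicit Defensive.

Import Order.TTheory GRing.Theory Num.Theory.
Import numFieldNormedType.Exports.

Local Open Scope classical_set_scope.
Local Open Scope ring_scope.

(* [Quat a b c d] is a + b i + c j + d k. *)
Record quat (R : Type) := Quat { qre : R; qi : R; qj : R; qk : R }.

Section QuatChoice.
Variable R : Type.

Definition quat_to_prod (q : quat R) : R * R * R * R :=
  (qre q, qi q, qj q, qk q).
Definition quat_of_prod (p : R * R * R * R) : quat R :=
  let: (a, b, c, d) := p in Quat a b c d.

Lemma quat_to_prodK : cancel quat_to_prod quat_of_prod.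
Proof. by case. Qed.

End QuatChoice.

HB.instance Definition _ (R : choiceType) :=
  Choice.copy (quat R) (can_type (@quat_to_prodK R)).

Section QuatAlgebra.
Variable R : realType.
Implicit Types p q r : quat R.

Definition quat0 : quat R := Quat 0 0 0 0.
Definition quat1 : quat R := Quat 1 0 0 0.
Definition quat_opp q := Quat (- qre q) (- qi q) (- qj q) (- qk q).
Definition quat_add p q :=
  Quat (qre p + qre q) (qi p + qi q) (qj p + qj q) (qk p + qk q).
Definition quat_scale (a : R) q :=
  Quat (a * qre q) (a * qi q) (a * qj q) (a * qk q).
Definition quat_mul p q :=
  Quat (qre p * qre q - qi p * qi q - qj p * qj q - qk p * qk q)
       (qre p * qi q + qi p * qre q + qj p * qk q - qk p * qj q)
       (qre p * qj q - qi p * qk q + qj p * qre q + qk p * qi q)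
       (qre p * qk q + qi p * qj q - qj p * qi q + qk p * qre q).
Definition quat_norm q : R :=
  Num.sqrt (qre q ^+ 2 + qi q ^+ 2 + qj q ^+ 2 + qk q ^+ 2).

Local Ltac qring :=
  rewrite /quat_add /quat_mul /quat_opp /quat_scale /quat0 /quat1 /=;
  congr Quat; ring.

Lemma quat_addA : associative quat_add.
Proof. by move=> [? ? ? ?] [? ? ? ?] [? ? ? ?]; qring. Qed.
Lemma quat_addC : commutative quat_add.
Proof. by move=> [? ? ? ?] [? ? ? ?]; qring. Qed.
Lemma quat_add0 : left_id quat0 quat_add.
Proof. by move=> [? ? ? ?]; qring. Qed.
Lemma quat_addN : left_inverse quat0 quat_opp quat_add.
Proof. by move=> [? ? ? ?]; qring. Qed.

HB.instance Definition _ :=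
  GRing.isZmodule.Build (quat R) quat_addA quat_addC quat_add0 quat_addN.

Lemma quat_mulA : associative quat_mul.
Proof. by move=> [? ? ? ?] [? ? ? ?] [? ? ? ?]; qring. Qed.
Lemma quat_mul1q : left_id quat1 quat_mul.
Proof. by move=> [? ? ? ?]; qring. Qed.
Lemma quat_mulq1 : right_id quat1 quat_mul.
Proof. by move=> [? ? ? ?]; qring. Qed.
Lemma quat_mulDl : left_distributive quat_mul quat_add.
Proof. by move=> [? ? ? ?] [? ? ? ?] [? ? ? ?]; qring. Qed.
Lemma quat_mulDr : right_distributive quat_mul quat_add.
Proof. by move=> [? ? ? ?] [? ? ? ?] [? ? ? ?]; qring. Qed.
Lemma quat1_neq0 : quat1 != 0.
Proof. by apply/eqP => -[/eqP]; rewrite oner_eq0. Qed.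

HB.instance Definition _ := GRing.Zmodule_isNzRing.Build (quat R)
  quat_mulA quat_mul1q quat_mulq1 quat_mulDl quat_mulDr quat1_neq0.

Lemma quat_scaleA (a b : R) q :
  quat_scale a (quat_scale b q) = quat_scale (a * b) q.
Proof. by case: q => *; qring. Qed.
Lemma quat_scale1 : left_id 1 quat_scale.
Proof. by move=> [? ? ? ?]; qring. Qed.
Lemma quat_scaleDr : right_distributive quat_scale quat_add.
Proof. by move=> ? [? ? ? ?] [? ? ? ?]; qring. Qed.
Lemma quat_scaleDl q (a b : R) :
  quat_scale (a + b) q = quat_add (quat_scale a q) (quat_scale b q).
Proof. by case: q => *; qring. Qed.

HB.instance Definition _ := GRing.Zmodule_isLmodule.Build R (quat R)
  quat_scaleA quat_scale1 quat_scaleDr quat_scaleDl.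

Lemma quat_scaleAl (a : R) p q :
  quat_scale a (quat_mul p q) = quat_mul (quat_scale a p) q.
Proof. by case: p q => [? ? ? ?] [? ? ? ?]; qring. Qed.

HB.instance Definition _ :=
  GRing.Lmodule_isLalgebra.Build R (quat R) quat_scaleAl.

Lemma quat_scaleAr (a : R) p q :
  quat_scale a (quat_mul p q) = quat_mul p (quat_scale a q).
Proof. by case: p q => [? ? ? ?] [? ? ? ?]; qring. Qed.

HB.instance Definition _ :=
  GRing.Lalgebra_isAlgebra.Build R (quat R) quat_scaleAr.

Lemma quat_normD p q : quat_norm (quat_add p q) <= quat_norm p + quat_norm q.
Proof.
case: p q => [a b c d] [a' b' c' d']; rewrite /quat_norm /=.
set s := a ^+ 2 + b ^+ 2 + c ^+ 2 + d ^+ 2.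
set t := a' ^+ 2 + b' ^+ 2 + c' ^+ 2 + d' ^+ 2.
have s0 : 0 <= s by rewrite /s !addr_ge0 ?sqr_ge0.
have t0 : 0 <= t by rewrite /t !addr_ge0 ?sqr_ge0.
rewrite -(@ler_pXn2r _ 2)// ?nnegrE ?addr_ge0 ?sqrtr_ge0//.
set v := (a + a') ^+ 2 + _ + _ + _.
have v0 : 0 <= v by rewrite /v !addr_ge0 ?sqr_ge0.
rewrite (sqr_sqrtr v0) sqrrD (sqr_sqrtr s0) (sqr_sqrtr t0) -sqrtrM//.
set u := a * a' + b * b' + c * c' + d * d'.
have uE : u <= Num.sqrt (s * t).
  apply: (le_trans (ler_norm u)).
  rewrite -sqrtr_sqr ler_wsqrtr//.
  rewrite -subr_ge0 (_ : _ - _ = (a * b' - b * a') ^+ 2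
     + (a * c' - c * a') ^+ 2 + (a * d' - d * a') ^+ 2
     + (b * c' - c * b') ^+ 2 + (b * d' - d * b') ^+ 2
     + (c * d' - d * c') ^+ 2); last by rewrite /u /s /t; ring.
  by rewrite !addr_ge0 ?sqr_ge0.
rewrite (_ : v = s + u *+ 2 + t); last by rewrite /v /u /s /t; ring.
by rewrite lerD2r lerD2l lerMn2r uE orbT.
Qed.

Lemma quat_normZ (a : R) q : quat_norm (quat_scale a q) = `|a| * quat_norm q.
Proof.
case: q => [b c d e]; rewrite /quat_norm /= -sqrtr_sqr -sqrtrM ?sqr_ge0//.
by congr Num.sqrt; ring.
Qed.

Lemma quat_norm0_eq0 q : quat_norm q = 0 -> q = 0.
Proof.
case: q => [a b c d] /eqP; rewrite /quat_norm /= sqrtr_eq0 => h.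
have [ha hb hc hd] := And4 (sqr_ge0 a) (sqr_ge0 b) (sqr_ge0 c) (sqr_ge0 d).
have z (x : R) : x ^+ 2 <= 0 -> x = 0.
  by move=> hx; apply/eqP; rewrite -sqrf_eq0 eq_le hx sqr_ge0.
by congr Quat; apply: z; lra.
Qed.

(* The norm, and hence the topology of H, is the Euclidean one of R^4. *)
HB.instance Definition _ := Lmodule_isNormed.Build R (quat R)
  quat_normD quat_normZ quat_norm0_eq0.

End QuatAlgebra.

Section SliceRegular.
Variable R : realType.

Definition imag_unit : set (quat R) := [set q | qre q = 0 /\ `|q| = 1].

Definition slice_pt (I : quat R) (x y : R) : quat R := x%:A + y *: I.

Definition slice (I : quat R) : set (quat R) :=
  [set q | exists x y, q = slice_pt I x y].

Definition real_axis : set (quat R) := range (fun x : R => x%:A).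

Definition domain (T : topologicalType) (D : set T) : Prop :=
  [/\ D !=set0, open D & connected D].

(* "Domain in L_I" refers to the subspace topology of L_I. The library's
   [subspace A] retopologizes the whole type, with the points outside A
   isolated, so on subsets of A it gives the relative topology of A. *)
Definition slice_domain (U : set (quat R)) : Prop :=
  [/\ domain U,
      U `&` real_axis !=set0 &
      forall I, imag_unit I ->
        domain (U `&` slice I : set (subspace (slice I)))].

Definition circular (U : set (quat R)) : Prop :=
  forall x y I, imag_unit I -> U (slice_pt I x y) ->
    [set slice_pt J x y | J in imag_unit] `<=` U.

(* f_I in the real coordinates (x, y) of L_I. *)
Definition slice_restr (f : quat R -> quat R) (I : quat R) (p : R * R) :
  quat R := f (slice_pt I p.1 p.2).

(* f is a total function, but as U is open its values outside U are
   irrelevant to the derivatives at points of U. *)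
Definition slice_regular (U : set (quat R)) (f : quat R -> quat R) : Prop :=
  forall I, imag_unit I -> forall x y : R, U (slice_pt I x y) ->
    differentiable (slice_restr f I) (x, y) /\
    2^-1 *: ('D_(1, 0) (slice_restr f I) (x, y)
             + I * 'D_(0, 1) (slice_restr f I) (x, y)) = 0.

End SliceRegular.

(* Main.v *)
Require Import Defs.
From HB Require Import structures.
From mathcomp Require Import all_boot all_order all_algebra.
From mathcomp Require Import all_classical all_reals all_analysis.
From mathcomp Require Import ring lra.
Import Order.TTheory GRing.Theory Num.Theory numFieldNormedType.Exports.
Local Open Scope classical_set_scope.
Local Open Scope ring_scope.
Set Implicit Arguments.
Unset Strict Implicit.
Unset Printing Implicit Defensive.

(** On the slice of I, the right-hand side of the formula is a function of
    (x, y) built from the restriction of f to the slice of J. Left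
    multiplication by I, together with I ^ 2 = J ^ 2 = -1, makes it satisfy the
    Cauchy-Riemann equation of the slice of I as soon as f satisfies that of the
    slice of J ([representation_holomorphic]). It agrees with f on the real
    axis, where J drops out. The formula is therefore an instance of the
    identity principle on the connected open set that Omega cuts out of the
    plane of I ([real_axis_vanishing]).

    The identity principle has to be proved for functions that are only
    differentiable at each point, with no continuity of the derivatives. The
    functionals q |-> Re (e q) turn a quaternion-valued function into pairs
    (u, w) of real functions of two real variables such that u + i w is
    holomorphic, and the argument is about such pairs h = u + i w.

    - The Cauchy-Goursat theorem on rectangles ([goursat]) is the only source of
      regularity.
    - Let h be holomorphic on a half-plane Re z < L and have period 2 i pi.
      The product of h with its Schwarz reflection in the line Re z = c equals
      |h| ^ 2 on that line. By Goursat and periodicity its integrals along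
      vertical segments of length 2 pi agree wherever it is defined. If h
      vanishes for Re z < a and 2 c - a < L, one of these segments lies where h
      is 0, so the integral of |h| ^ 2 is 0 and h vanishes on Re z = c
      ([strip_reflection]). Iterating, h vanishes for Re z < L
      ([strip_vanishing]).
    - Through the exponential, a holomorphic function on a disc that vanishes
      near the centre vanishes on the disc ([disc_vanishing]); connectedness
      then gives the identity principle for zero sets with interior points
      ([identity_principle]).
    - If h vanishes on the real axis, its derivative vanishes there too, so
      replacing h by 0 on a closed half-plane bounded by the axis keeps it
      holomorphic. The modified function vanishes on a nonempty open set, hence
      everywhere, so h is 0 on the other half-plane. *)

(** * Gradients of functions of two real variables *)

Section DiffExpansion.
Variables (R : realType) (V W : normedModType R).

(** The epsilon form of the little-o in the definition of the differential: it
    is what uniform estimates on small rectangles need, and it passes to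
    functions that are pointwise smaller. *)
Lemma is_diff_expandP (f : V -> W) (df : {linear V -> W}) p : continuous df ->
  is_diff p f df <-> forall e, 0 < e -> \forall q \near p,
    `|f q - f p - df (q - p)| <= e * `|q - p|.
Proof.
move=> df_cts.
have expE : (f \o shift p = cst (f p) + df +o_ 0 id) <->
    forall e, 0 < e -> \forall q \near p,
      `|f q - f p - df (q - p)| <= e * `|q - p|.
  split=> [/eqaddoP H e e0|H]; last apply/eqaddoP => e e0; have := H e e0.
    rewrite (near_shift 0 p) => {}H; near=> h.
    rewrite /= subr0 addrK.
    have : `|((f \o shift p) - (cst (f p) + df)) h| <= e * `|h|.
      by near: h.
    by rewrite !fctE/= opprD addrA.
  rewrite (near_shift 0 p) => {}H; near=> h.
  have : (fun q => `|f q - f p - df (q - p)| <= e * `|q - p|) (h + (p - 0)).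
    by near: h.
  by rewrite subr0 addrK !fctE/= opprD addrA.
split=> [[du dE]|/expE H].
  by apply/expE; rewrite -dE; exact: diff_locally.
have dE := diff_unique df_cts H.
by apply: DiffDef => //; apply/diff_locallyP; rewrite dE.
Unshelve. all: by end_near. Qed.
End DiffExpansion.

Section Gradient.
Variable R : realType.
Implicit Types (u v : R * R -> R) (p q : R * R) (a b c d : R).

(** Differentiability in the sense of Frechet: the mere existence of the partial
    derivatives would not give the first-order expansion in both variables on
    which the Cauchy-Goursat argument rests. *)
Definition has_grad u p a b := is_diff p u (fun h : R * R => a * h.1 + b * h.2).

Lemma has_gradW u p a b a' b' :
  has_grad u p a b -> a = a' -> b = b' -> has_grad u p a' b'.
Proof. by move=> ? <- <-. Qed.

Lemma eq_has_grad u v p a b : u =1 v -> has_grad u p a b -> has_grad v p a b.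
Proof. by move=> /funext ->. Qed.

Lemma has_grad_continuous u p a b : has_grad u p a b -> {for p, continuous u}.
Proof. by case=> /differentiable_continuous. Qed.

Lemma has_grad_cst k p : has_grad (cst k) p 0 0.
Proof.
apply: is_diff_eq.
by apply/funext => h /=; rewrite !mul0r addr0.
Qed.

Lemma has_grad_fst p : has_grad fst p 1 0.
Proof.
have c : continuous (fst : R * R -> R) by move=> x; exact: cvg_fst.
apply: is_diff_eq.
  apply: DiffDef; last by rewrite diff_lin.
  exact: linear_differentiable.
by apply/funext => h /=; rewrite mul0r addr0 mul1r.
Qed.

Lemma has_grad_snd p : has_grad snd p 0 1.
Proof.
have c : continuous (snd : R * R -> R) by move=> x; exact: cvg_snd.
apply: is_diff_eq.
  apply: DiffDef; last by rewrite diff_lin.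
  exact: linear_differentiable.
by apply/funext => h /=; rewrite mul0r add0r mul1r.
Qed.

Lemma has_gradD u v p a b c d : has_grad u p a b -> has_grad v p c d ->
  has_grad (fun q => u q + v q) p (a + c) (b + d).
Proof.
move=> hu hv; apply: (is_diff_eq (is_diffD hu hv)).
by apply/funext => h; rewrite fctE; ring.
Qed.

Lemma has_gradN u p a b : has_grad u p a b ->
  has_grad (fun q => - u q) p (- a) (- b).
Proof.
move=> hu; apply: (is_diff_eq (is_diffN hu)).
by apply/funext => h; rewrite fctE; ring.
Qed.

Lemma has_gradB u v p a b c d : has_grad u p a b -> has_grad v p c d ->
  has_grad (fun q => u q - v q) p (a - c) (b - d).
Proof. by move=> hu hv; apply/has_gradD/has_gradN. Qed.

Lemma has_gradM u v p a b c d : has_grad u p a b -> has_grad v p c d ->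
  has_grad (fun q => u q * v q) p (a * v p + u p * c) (b * v p + u p * d).
Proof.
move=> hu hv; apply: (is_diff_eq (is_diffM hu hv)).
by apply/funext => h; rewrite !fctE /GRing.scale/=; ring.
Qed.

Lemma has_grad_comp u x y p a b x1 x2 y1 y2 :
  has_grad u (x p, y p) a b -> has_grad x p x1 x2 -> has_grad y p y1 y2 ->
  has_grad (fun q => u (x q, y q)) p (a * x1 + b * y1) (a * x2 + b * y2).
Proof.
move=> hu hx hy; apply: (is_diff_eq (is_diff_comp (is_diff_pair hx hy) hu)).
by apply/funext => h /=; ring.
Qed.

Let is_diff_derive (g : R -> R) (t g' : R) : is_derive t 1 g g' ->
  is_diff t g (fun h => g' * h).
Proof.
move=> [/derivable1_diffP dg <-]; apply: DiffDef => //.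
apply/funext => h; rewrite deriveE// -[X in 'd _ _ X]mulr1.
by rewrite [in LHS]linearZ mulrC.
Qed.

Lemma has_grad_fst_comp (g : R -> R) p g' : is_derive p.1 1 g g' ->
  has_grad (fun q => g q.1) p g' 0.
Proof.
move=> /is_diff_derive hg.
apply: (is_diff_eq (is_diff_comp (has_grad_fst p) hg)).
by apply/funext => h /=; ring.
Qed.

Lemma has_grad_snd_comp (g : R -> R) p g' : is_derive p.2 1 g g' ->
  has_grad (fun q => g q.2) p 0 g'.
Proof.
move=> /is_diff_derive hg.
apply: (is_diff_eq (is_diff_comp (has_grad_snd p) hg)).
by apply/funext => h /=; ring.
Qed.

Lemma has_grad_expandP u p a b : has_grad u p a b <->
  forall e, 0 < e -> \forall q \near p,
    `|u q - u p - (a * (q.1 - p.1) + b * (q.2 - p.2))| <= e * `|q - p|.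
Proof.
pose df (h : R * R) := a * h.1 + b * h.2.
have df_lin : linear df by move=> k g h; rewrite /df/= /GRing.scale/=; ring.
pose dfL : {linear (R * R)%type -> R} :=
  HB.pack df (GRing.isLinear.Build _ _ _ _ _ df_lin).
apply: (@is_diff_expandP _ _ _ u dfL) => h.
apply: (@cvgD _ _ _ _ _ (fun h : R * R => a * h.1)
  (fun h : R * R => b * h.2)).
  by apply: cvgMr; exact: cvg_fst.
by apply: cvgMr; exact: cvg_snd.
Qed.

Lemma near_box p (A : R * R -> Prop) : (\forall q \near p, A q) <->
  exists2 d, 0 < d &
    forall q, `|q.1 - p.1| < d -> `|q.2 - p.2| < d -> A q.
Proof.
split=> [/nbhs_ballP[d /= d0 pA]|[d d0 pA]].
  exists d => // q q1 q2; apply: pA.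
  by split; rewrite /ball/= distrC.
apply/nbhs_ballP; exists d => // q [q1 q2].
by apply: pA; rewrite distrC.
Qed.

Lemma has_grad_box u p a b e : has_grad u p a b -> 0 < e ->
  exists2 d, 0 < d &
    forall q, `|q.1 - p.1| < d -> `|q.2 - p.2| < d ->
    `|u q - u p - (a * (q.1 - p.1) + b * (q.2 - p.2))|
      <= e * (`|q.1 - p.1| + `|q.2 - p.2|).
Proof.
move=> /has_grad_expandP H e0.
have /near_box[d d0 {}H] := H e e0; exists d => // q q1 q2.
apply: le_trans (H q q1 q2) _; apply: ler_wpM2l; first exact: ltW.
by rewrite prod_normE ge_max lerDl lerDr !normr_ge0.
Qed.

Lemma has_grad_near u v p a b :
  (\forall q \near p, u q = v q) -> has_grad u p a b -> has_grad v p a b.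
Proof.
move=> uv /has_grad_expandP H; apply/has_grad_expandP => e e0.
have uvp := nbhs_singleton uv.
by apply: filterS2 uv (H e e0) => q <-; rewrite uvp.
Qed.

End Gradient.

(** * Integrals of continuous functions over segments *)

Section SegmentIntegral.
Variable R : realType.
Implicit Types (f g : R -> R) (a b m k M : R).

Definition seg_int a b f : R := \int[lebesgue_measure]_(x in `[a, b]) f x.

(** Two-sided continuity, also at the end points, so that it restricts to
    subsegments at once. *)
Definition seg_continuous a b f :=
  forall x, a <= x <= b -> {for x, continuous f}.

Lemma seg_continuousS a b a' b' f : a <= a' -> b' <= b ->
  seg_continuous a b f -> seg_continuous a' b' f.
Proof.
move=> aa bb cf x /andP[ax xb]; apply: cf.
by rewrite (le_trans aa)//= (le_trans xb).
Qed.

Lemma seg_continuousB a b f g : seg_continuous a b f -> seg_continuous a b g ->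
  seg_continuous a b (fun x => f x - g x).
Proof. by move=> cf cg x xab; apply: cvgB; [exact: cf|exact: cg]. Qed.

Lemma seg_integrable a b f : seg_continuous a b f ->
  (@lebesgue_measure R).-integrable `[a, b] (EFin \o f).
Proof.
move=> cf; apply: continuous_compact_integrable; first exact: segment_compact.
by apply: continuous_in_subspaceT => x; rewrite inE/= in_itv/=; exact: cf.
Qed.

Lemma seg_int_split a m b f : a <= m <= b -> seg_continuous a b f ->
  seg_int a b f = seg_int a m f + seg_int m b f.
Proof.
move=> /andP[am mb] /seg_integrable fi; rewrite /seg_int.
rewrite -(@Rintegral_itv_obnd_cbnd _ m (BRight b)); last first.
  apply: integrableS fi => //=.
  by apply: subset_itv; rewrite bnd_simp.
rewrite -(@Rintegral_itvB _ f (BLeft a) (BRight b) m) ?bnd_simp//.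
by rewrite addrC subrK.
Qed.

Lemma seg_intB a b f g : seg_continuous a b f -> seg_continuous a b g ->
  seg_int a b (fun x => f x - g x) = seg_int a b f - seg_int a b g.
Proof.
by move=> /seg_integrable fi /seg_integrable gi; rewrite /seg_int RintegralB.
Qed.

Lemma eq_seg_int a b f g : (forall x, a <= x <= b -> f x = g x) ->
  seg_int a b f = seg_int a b g.
Proof.
move=> fg; apply: eq_Rintegral => x; rewrite inE/= in_itv/=; exact: fg.
Qed.

Lemma seg_int_cst a b k : a <= b -> seg_int a b (cst k) = k * (b - a).
Proof.
move=> ab; rewrite /seg_int Rintegral_cst//= lebesgue_measure_itv/=.
case: ifPn => //; rewrite lte_fin -leNgt => ba.
by rewrite (le_anti (introT andP (conj ab ba))) subrr.
Qed.

Lemma le_seg_int a b f g : seg_continuous a b f -> seg_continuous a b g ->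
  (forall x, a <= x <= b -> f x <= g x) -> seg_int a b f <= seg_int a b g.
Proof.
move=> /seg_integrable fi /seg_integrable gi fg.
by apply: le_Rintegral => //= x; rewrite in_itv/=; exact: fg.
Qed.

Lemma seg_int_mean a b f k M : a <= b -> seg_continuous a b f ->
  (forall x, a <= x <= b -> `|f x - k| <= M) ->
  `|seg_int a b f - k * (b - a)| <= M * (b - a).
Proof.
move=> ab cf fk.
have ccst (c : R) : seg_continuous a b (cst c) by move=> x _; exact: cvg_cst.
have lo : (k - M) * (b - a) <= seg_int a b f.
  rewrite -seg_int_cst//; apply: le_seg_int => // x /fk.
  by rewrite ler_distl => /andP[].
have hi : seg_int a b f <= (k + M) * (b - a).
  rewrite -seg_int_cst//; apply: le_seg_int => // x /fk.
  by rewrite ler_distl => /andP[].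
by rewrite ler_distl -mulrBl -mulrDl lo hi.
Qed.

Lemma seg_int_ge0_eq0 a b f : a < b -> seg_continuous a b f ->
  (forall x, a <= x <= b -> 0 <= f x) -> seg_int a b f = 0 ->
  forall x, a <= x <= b -> f x = 0.
Proof.
move=> ab cf f0 I0 x /andP[ax xb]; apply/eqP/negPn/negP => fx.
have fx0 : 0 < f x by rewrite lt_neqAle eq_sym fx f0// ax xb.
have /cvgrPdist_lt /(_ (f x / 2)) : {for x, continuous f}.
  by apply: cf; rewrite ax.
have fx2 : 0 < f x / 2 by rewrite divr_gt0.
move=> /(_ fx2) /nbhs_ballP [d /= d0 xd].
(* a nondegenerate subsegment around x on which f is at least f x / 2 *)
pose p := Num.max a (x - d / 2); pose q := Num.min b (x + d / 2).
have [ap px] : a <= p /\ p <= x.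
  by rewrite le_max lexx ge_max ax; split=> //; rewrite gerBl ltW// divr_gt0.
have [qb xq] : q <= b /\ x <= q.
  by rewrite ge_min lexx le_min xb; split=> //; rewrite lerDl ltW// divr_gt0.
have pq : p < q.
  by rewrite lt_min !gt_max ab; apply/andP; split; apply/andP; split => //; lra.
have ge0 u v : a <= u -> v <= b -> 0 <= seg_int u v f.
  move=> au vb; apply: Rintegral_ge0 => t /=; rewrite in_itv/= => /andP[ut tv].
  by rewrite f0// (le_trans au)// (le_trans tv).
have : f x / 2 * (q - p) <= seg_int p q f.
  rewrite -(seg_int_cst _ (ltW pq)); apply: le_seg_int.
  - by move=> t _; exact: cvg_cst.
  - exact: seg_continuousS cf.
  move=> t /andP[pt tq].
  have : ball x d t.
    rewrite /ball/= ltr_distlC.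
    move: pt tq; rewrite ge_max le_min => /andP[_ pt] /andP[_ tq].
    by apply/andP; split; lra.
  by move=> /xd; rewrite ltr_distlC => /andP[+ _]; rewrite /=; lra.
have : 0 < f x / 2 * (q - p) by rewrite mulr_gt0// subr_gt0.
have bp : p <= b by rewrite (le_trans (ltW pq)).
have c1 := seg_continuousS ap (lexx b) cf.
move: I0; rewrite (@seg_int_split a p) ?ap// (@seg_int_split p q) ?(ltW pq)//.
have := ge0 _ _ (lexx a) bp; have := ge0 _ _ (le_trans ap (ltW pq)) (lexx b).
by lra.
Qed.

End SegmentIntegral.

(** * The Cauchy-Goursat theorem for rectangles *)

Section Goursat.
Variables (R : realType) (P Q : R * R -> R).
Implicit Types (a b c d x y e k : R) (p q : R * R).

Definition in_rect a b c d p := (a <= p.1 <= b) && (c <= p.2 <= d).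

(** The integral of P dx + Q dy along the boundary of [a, b] x [c, d], run
    counterclockwise. *)
Definition circulation a b c d :=
  seg_int a b (fun x => P (x, c)) + seg_int c d (fun y => Q (b, y))
  - seg_int a b (fun x => P (x, d)) - seg_int c d (fun y => Q (a, y)).

Lemma continuous_hsection (u : R * R -> R) a b y :
  (forall x, a <= x <= b -> {for (x, y), continuous u}) ->
  seg_continuous a b (fun x => u (x, y)).
Proof.
move=> cu x /cu cx; have cp : {for x, continuous (fun x : R => (x, y))}.
  by have := cvg_pair (@cvg_id _ (nbhs x)) (@cvg_cst _ y R (nbhs x) _); apply.
exact: (continuous_comp cp cx).
Qed.

Lemma continuous_vsection (u : R * R -> R) c d x :
  (forall y, c <= y <= d -> {for (x, y), continuous u}) ->
  seg_continuous c d (fun y => u (x, y)).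
Proof.
move=> cu y /cu cy; have cp : {for y, continuous (fun y : R => (x, y))}.
  by have := cvg_pair (@cvg_cst _ x R (nbhs y) _) (@cvg_id _ (nbhs y)); apply.
exact: (continuous_comp cp cy).
Qed.

Section Rectangle.
Variables (a b c d : R).
Hypothesis P_cts : forall p, in_rect a b c d p -> {for p, continuous P}.
Hypothesis Q_cts : forall p, in_rect a b c d p -> {for p, continuous Q}.

Let ctsP y : c <= y <= d -> seg_continuous a b (fun x => P (x, y)).
Proof.
move=> cyd; apply: continuous_hsection => x axb.
by apply: P_cts; rewrite /in_rect axb.
Qed.

Let ctsQ x : a <= x <= b -> seg_continuous c d (fun y => Q (x, y)).
Proof.
move=> axb; apply: continuous_vsection => y cyd.
by apply: Q_cts; rewrite /in_rect axb.
Qed.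

Lemma circulation_split (m n : R) : a <= m <= b -> c <= n <= d ->
  circulation a b c d = circulation a m c n + circulation m b c n
    + circulation a m n d + circulation m b n d.
Proof.
move=> amb cnd; have /andP[am mb] := amb; have /andP[cn nd] := cnd.
have ab := le_trans am mb; have cd := le_trans cn nd.
rewrite /circulation !(seg_int_split amb (ctsP _)) ?lexx ?cd//.
rewrite !(seg_int_split cnd (ctsQ _)) ?lexx ?ab//.
ring.
Qed.

(** An affine field with equal cross derivatives k has zero circulation, so only
    the deviation from it counts, twice for each pair of opposite sides. *)
Lemma circulation_small p k al be e : in_rect a b c d p ->
  (forall q, in_rect a b c d q ->
    `|P q - P p - (al * (q.1 - p.1) + k * (q.2 - p.2))| <= e) ->
  (forall q, in_rect a b c d q ->
    `|Q q - Q p - (k * (q.1 - p.1) + be * (q.2 - p.2))| <= e) ->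
  `|circulation a b c d| <= 2 * e * ((b - a) + (d - c)).
Proof.
move=> /andP[/andP[ap pb] /andP[cp pd]] hP hQ.
have ab := le_trans ap pb; have cd := le_trans cp pd.
(* pairing opposite sides, the contributions of k cancel *)
have -> : circulation a b c d =
    (seg_int a b (fun x => P (x, c) - P (x, d)) - - (k * (d - c)) * (b - a))
    + (seg_int c d (fun y => Q (b, y) - Q (a, y)) - k * (b - a) * (d - c)).
  rewrite !seg_intB ?/circulation; last first.
  - by apply: ctsP; rewrite cd lexx.
  - by apply: ctsP; rewrite cd lexx.
  - by apply: ctsQ; rewrite ab lexx.
  - by apply: ctsQ; rewrite ab lexx.
  ring.
rewrite [leRHS]mulrDr; apply: le_trans (ler_normD _ _) _; apply: lerD.
  apply: seg_int_mean => //.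
    by apply: seg_continuousB; apply: ctsP; rewrite cd lexx.
  move=> x axb.
  have := hP (x, c); have := hP (x, d); rewrite /in_rect/= axb cd !lexx.
  move=> /(_ isT) h1 /(_ isT) h2; rewrite mulr_natl mulr2n.
  apply: le_trans (lerD h2 h1); apply: le_trans (ler_normB _ _).
  by rewrite le_eqVlt; apply/orP; left; apply/eqP; congr (`|_|); ring.
apply: seg_int_mean => //.
  by apply: seg_continuousB; apply: ctsQ; rewrite ab lexx.
move=> y cyd.
have := hQ (b, y); have := hQ (a, y); rewrite /in_rect/= cyd ab !lexx.
move=> /(_ isT) h1 /(_ isT) h2; rewrite mulr_natl mulr2n.
apply: le_trans (lerD h2 h1); apply: le_trans (ler_normB _ _).
by rewrite le_eqVlt; apply/orP; left; apply/eqP; congr (`|_|); ring.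
Qed.

End Rectangle.

Lemma nested_segments (x w : nat -> R) :
  (forall n, x n <= x n.+1) -> (forall n, x n.+1 + w n.+1 <= x n + w n) ->
  (forall n, 0 <= w n) ->
  exists z, forall n, x n <= z <= x n + w n.
Proof.
move=> xn wn w0.
have xle i j : (i <= j)%N -> x i <= x j.
  by move/nondecreasing_seqP : xn; exact.
have wle i j : (i <= j)%N -> x j + w j <= x i + w i.
  by move/(@nonincreasing_seqP _ _ (fun i => x i + w i)) : wn; exact.
have xw i j : x i <= x j + w j.
  have xm := xle _ _ (leq_maxl i j); have wm := wle _ _ (leq_maxr i j).
  by apply: le_trans xm (le_trans _ wm); rewrite lerDl.
exists (sup (range x)) => n; apply/andP; split.
  apply: ub_le_sup; last by exists n.
  by exists (x 0%N + w 0%N) => _ [i _ <-].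
by apply: ge_sup; [exists (x n); exists n|move=> _ [i _ <-]].
Qed.

(** Differentiability at each point suffices because the estimate is made at a
    single point. A nonzero circulation E survives repeated quartering with size
    at least E / 4 ^ n, which is proportional to the area of the n-th
    rectangle. At the common point of the nested rectangles the field is affine
    with equal cross derivatives up to an error that is small compared with the
    diameter, so its circulation is small compared with the area. *)
Lemma goursat a b c d : a <= b -> c <= d ->
  (forall p, in_rect a b c d p ->
     exists al k be, has_grad P p al k /\ has_grad Q p k be) ->
  circulation a b c d = 0.
Proof.
move=> ab cd closed; apply/eqP/negPn/negP => C0.
pose A := b - a; pose B := d - c.
have A0 : 0 <= A by rewrite subr_ge0.
have B0 : 0 <= B by rewrite subr_ge0.
pose h n : R := 2^-1 ^+ n.
have h0 n : 0 < h n by rewrite exprn_gt0.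
have hS n : h n = h n.+1 + h n.+1 by rewrite /h exprS; lra.
(* [circ n p] and [inside n p] refer to the rectangle of the n-th generation
   whose lower left corner is p *)
pose circ n p := circulation p.1 (p.1 + A * h n) p.2 (p.2 + B * h n).
pose inside n p := [/\ a <= p.1, p.1 + A * h n <= b, c <= p.2
  & p.2 + B * h n <= d].
have in_sub n p q : inside n p ->
    in_rect p.1 (p.1 + A * h n) p.2 (p.2 + B * h n) q -> in_rect a b c d q.
  move=> [p1 p2 p3 p4] /andP[/andP[q1 q2] /andP[q3 q4]].
  rewrite /in_rect (le_trans p1)// (le_trans q2)//=.
  by rewrite (le_trans p3)// (le_trans q4).
have P_cts p : in_rect a b c d p -> {for p, continuous P}.
  by move=> /closed [? [? [? [/has_grad_continuous]]]].
have Q_cts p : in_rect a b c d p -> {for p, continuous Q}.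
  by move=> /closed [? [? [? [_ /has_grad_continuous]]]].
pose quarter n p q := (q.1 = p.1 \/ q.1 = p.1 + A * h n.+1) /\
  (q.2 = p.2 \/ q.2 = p.2 + B * h n.+1).
have Ah n : 0 <= A * h n by rewrite mulr_ge0// ltW.
have Bh n : 0 <= B * h n by rewrite mulr_ge0// ltW.
have quarter_inside n p q : inside n p -> quarter n p q -> inside n.+1 q.
  move=> [p1 p2 p3 p4] [q1 q2]; move: p2 p4 (Ah n.+1) (Bh n.+1).
  rewrite hS !mulrDr => p2 p4 Ah1 Bh1.
  by split; [case: q1|case: q1|case: q2|case: q2] => ->; lra.
have /choice[f fP] (s : nat * (R * R)) : exists q, inside s.1 s.2 ->
    quarter s.1 s.2 q /\ `|circ s.1 s.2| <= 4 * `|circ s.1.+1 q|.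
  case: s => n p /=; have [ip|] := pselect (inside n p); last by exists p.
  have Ah1 := Ah n.+1; have Bh1 := Bh n.+1.
  have : circ n p = circ n.+1 p + circ n.+1 (p.1 + A * h n.+1, p.2)
      + circ n.+1 (p.1, p.2 + B * h n.+1)
      + circ n.+1 (p.1 + A * h n.+1, p.2 + B * h n.+1).
    rewrite /circ (@circulation_split _ _ _ _ _ _
      (p.1 + A * h n.+1) (p.2 + B * h n.+1)).
    - by rewrite /= -!addrA -!mulrDr -!hS.
    - by move=> q /(in_sub _ _ _ ip); exact: P_cts.
    - by move=> q /(in_sub _ _ _ ip); exact: Q_cts.
    - by rewrite (hS n) mulrDr; lra.
    - by rewrite (hS n) mulrDr; lra.
  move=> ->; set c1 := circ _ _; set c2 := circ _ _; set c3 := circ _ _.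
  set c4 := circ _ _.
  apply: contrapT => /forallNP no.
  have lt q : quarter n p q -> `|circ n.+1 q| < `|c1 + c2 + c3 + c4| / 4.
    move=> qq; rewrite ltNge; apply/negP => le; apply: (no q) => _; split=> //.
    by rewrite -ler_pdivrMl// mulrC.
  have l1 : `|c1| < _ := lt p (conj (or_introl erefl) (or_introl erefl)).
  have l2 : `|c2| < _ := lt (_, _) (conj (or_intror erefl) (or_introl erefl)).
  have l3 : `|c3| < _ := lt (_, _) (conj (or_introl erefl) (or_intror erefl)).
  have l4 : `|c4| < _ := lt (_, _) (conj (or_intror erefl) (or_intror erefl)).
  have := ler_normD (c1 + c2 + c3) c4; have := ler_normD (c1 + c2) c3.
  by have := ler_normD c1 c2; lra.
pose fix s n := if n is n'.+1 then f (n', s n') else (a, c).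
have s_in n : inside n (s n).
  elim: n => [|n ih].
    by split; rewrite /= ?lexx// /h expr0 mulr1 /A /B addrC subrK.
  by have /= [/(quarter_inside _ _ _ ih)] := fP (n, s n) ih.
have s_q n : quarter n (s n) (s n.+1) by have [] := fP (n, s n) (s_in n).
have s_big n : `|circulation a b c d| * h n ^+ 2 <= `|circ n (s n)|.
  elim: n => [|n ih].
    rewrite /circ/= /h expr0 expr1n !mulr1 /A /B.
    by rewrite (addrC a) (addrC c) !subrK.
  have [_ /= le4] := fP (n, s n) (s_in n).
  have := le_trans ih le4; rewrite -/(s n.+1) hS => le.
  rewrite -(@ler_pM2l _ 4)//; apply: le_trans le.
  by rewrite le_eqVlt; apply/orP; left; apply/eqP; ring.
have [x0 x0P] : exists x0, forall n, (s n).1 <= x0 <= (s n).1 + A * h n.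
  apply: nested_segments => // n; have := Ah n.+1; rewrite ?(hS n) ?mulrDr.
    by have [[->|->] _] := s_q n; lra.
  by have [[->|->] _] := s_q n; lra.
have [y0 y0P] : exists y0, forall n, (s n).2 <= y0 <= (s n).2 + B * h n.
  apply: nested_segments => // n; have := Bh n.+1; rewrite ?(hS n) ?mulrDr.
    by have [_ [->|->]] := s_q n; lra.
  by have [_ [->|->]] := s_q n; lra.
pose p := (x0, y0).
have pin n : in_rect (s n).1 ((s n).1 + A * h n) (s n).2 ((s n).2 + B * h n) p.
  by rewrite /in_rect x0P y0P.
have [al [k [be [gP gQ]]]] := closed p (in_sub _ _ _ (s_in 0%N) (pin 0%N)).
pose S := (A + B) ^+ 2.
have S0 : 0 <= S by exact: sqr_ge0.
pose E := `|circulation a b c d|.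
have E0 : 0 < E by rewrite normr_gt0.
(* chosen so that 2 * e * S < E, where 2 * e * S bounds the circulation of the
   n-th rectangle divided by h n ^ 2 *)
pose e := E / (2 * S + 1).
have S1 : 0 < 2 * S + 1 by rewrite ltr_wpDl// mulr_ge0.
have e0 : 0 < e by rewrite divr_gt0.
have [d1 d10 H1] := has_grad_box gP e0.
have [d2 d20 H2] := has_grad_box gQ e0.
have AB1 : 0 < A + B + 1 by rewrite ltr_wpDl// addr_ge0.
pose dl := Num.min d1 d2 / (A + B + 1).
have dl0 : 0 < dl by rewrite divr_gt0// lt_min d10.
have [n hn] : exists n, h n < dl.
  have [n _ /(_ n (leqnn n)) hn] := near_infty_natSinv_expn_lt (PosNum dl0).
  by exists n; rewrite /h exprVn -div1r.
have bound (q : R * R) :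
    in_rect (s n).1 ((s n).1 + A * h n) (s n).2 ((s n).2 + B * h n) q ->
    `|q.1 - p.1| <= A * h n /\ `|q.2 - p.2| <= B * h n.
  move=> /andP[/andP[q1 q2] /andP[q3 q4]].
  have /andP[p1 p2] := x0P n; have /andP[p3 p4] := y0P n.
  by split; rewrite ler_norml; apply/andP; split; rewrite /p/=; lra.
have small : (A + B + 1) * h n < Num.min d1 d2.
  by rewrite mulrC -ltr_pdivlMr.
have [sm1 sm2] : (A + B + 1) * h n < d1 /\ (A + B + 1) * h n < d2.
  by move: small; rewrite lt_min => /andP.
have hAB : (A + B + 1) * h n = A * h n + B * h n + h n by ring.
have hn0 := h0 n; have Ahn := Ah n; have Bhn := Bh n.
have e_mono (q : R * R) :
    `|q.1 - p.1| <= A * h n /\ `|q.2 - p.2| <= B * h n ->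
    e * (`|q.1 - p.1| + `|q.2 - p.2|) <= e * (A * h n + B * h n).
  by move=> [q1 q2]; rewrite ler_pM2l// lerD.
have : `|circ n (s n)| <= 2 * (e * (A * h n + B * h n)) *
    ((s n).1 + A * h n - (s n).1 + ((s n).2 + B * h n - (s n).2)).
  apply: (@circulation_small _ _ _ _ _ _ p k al be) => //.
  - by move=> q iq; exact: P_cts (in_sub _ _ _ (s_in n) iq).
  - by move=> q iq; exact: Q_cts (in_sub _ _ _ (s_in n) iq).
  - move=> q /bound qb; apply: le_trans (e_mono q qb); case: qb => q1 q2.
    by apply: H1; [apply: le_lt_trans q1 _|apply: le_lt_trans q2 _]; lra.
  - move=> q /bound qb; apply: le_trans (e_mono q qb); case: qb => q1 q2.
    by apply: H2; [apply: le_lt_trans q1 _|apply: le_lt_trans q2 _]; lra.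
move=> /(le_trans (s_big n)).
have -> : 2 * (e * (A * h n + B * h n)) * ((s n).1 + A * h n - (s n).1
    + ((s n).2 + B * h n - (s n).2)) = 2 * e * S * h n ^+ 2.
  by rewrite /S; ring.
rewrite ler_pM2r ?exprn_gt0//.
have : e * (2 * S + 1) = E by rewrite /e divfK// gt_eqF.
rewrite -/E; lra.
Qed.

End Goursat.

(** * Vanishing of holomorphic functions on strips and discs *)

(** u + i w has complex derivative a - i b at p. *)
Definition cauchy_riemann (R : realType) (u w : R * R -> R) (p : R * R) :=
  exists a b, has_grad u p a b /\ has_grad w p (- b) a.

Section Strip.
Variables (R : realType) (u w : R * R -> R) (L t1 t2 : R).
Hypothesis t12 : t1 < t2.
Hypothesis uw_holo : forall p, p.1 < L -> cauchy_riemann u w p.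
Hypothesis uw_periodic :
  forall s, u (s, t1) = u (s, t2) /\ w (s, t1) = w (s, t2).

(** With h = u + i w and the Schwarz reflection h' of h in the line s = c, that
    is h' (s, t) = conj (h (2 c - s, t)), the product h h' is holomorphic for
    a <= s <= c. Goursat on [a, c] x [t1, t2], whose horizontal sides cancel by
    periodicity, equates the integrals of Re (h h') along s = a, where h is 0,
    and along s = c, where h h' = |h| ^ 2. *)
Lemma strip_reflection (a c : R) : a <= c -> 2 * c - a < L ->
  (forall t, t1 <= t <= t2 -> u (a, t) = 0 /\ w (a, t) = 0) ->
  forall t, t1 <= t <= t2 -> u (c, t) = 0 /\ w (c, t) = 0.
Proof.
move=> ac caL zero.
pose refl (q : R * R) := (2 * c - q.1, q.2).
(* P = Im (h h') and Q = Re (h h'), so that P ds + Q dt = Im (h h' dz) *)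
pose P q := w q * u (refl q) - u q * w (refl q).
pose Q q := u q * u (refl q) + w q * w (refl q).
have closed p : in_rect a c t1 t2 p -> exists al k be,
    has_grad P p al k /\ has_grad Q p k be.
  move=> /andP[/andP[ap pc] _].
  have pL : p.1 < L by lra.
  have rL : (refl p).1 < L by rewrite /=; lra.
  have [a1 [b1 [hu hw]]] := uw_holo pL.
  have [a2 [b2 [hur hwr]]] := uw_holo rL.
  have hx : has_grad (fun q => 2 * c - q.1) p (- 1) 0.
    apply: has_gradW (has_gradB (has_grad_cst (2 * c) p) (has_grad_fst p)) _ _.
      by rewrite add0r.
    by rewrite subr0.
  have hur' := has_grad_comp hur hx (has_grad_snd p).
  have hwr' := has_grad_comp hwr hx (has_grad_snd p).
  have gP := has_gradB (has_gradM hw hur') (has_gradM hu hwr').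
  have gQ := has_gradD (has_gradM hu hur') (has_gradM hw hwr').
  do 3 eexists; split; first exact: gP.
  by apply: has_gradW gQ _ _; [rewrite /refl/=; ring|reflexivity].
have Qc : seg_continuous t1 t2 (fun t => Q (c, t)).
  apply: continuous_vsection => t tt.
  have [|al [k [be [_ /has_grad_continuous//]]]] := closed (c, t).
  by rewrite /in_rect ac lexx.
have Q0 : seg_int t1 t2 (fun t => Q (c, t)) = 0.
  have := goursat ac (ltW t12) closed; rewrite /circulation.
  have -> : seg_int t1 t2 (fun t => Q (a, t)) = 0.
    rewrite (@eq_seg_int _ _ _ _ (cst 0)) ?seg_int_cst ?mul0r ?ltW// => t tt.
    by rewrite /Q; have [-> ->] := zero t tt; rewrite !mul0r addr0.
  have -> : (fun s => P (s, t1)) = (fun s => P (s, t2)).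
    apply/funext => s; rewrite /P/refl/=.
    have [-> ->] := uw_periodic s.
    by have [-> ->] := uw_periodic (2 * c - s).
  by lra.
have Q2 t : Q (c, t) = u (c, t) ^+ 2 + w (c, t) ^+ 2.
  rewrite /Q /refl/=; have -> : 2 * c - c = c by ring.
  by rewrite !expr2.
move=> t tt.
have : Q (c, t) = 0.
  apply: (seg_int_ge0_eq0 t12 Qc _ Q0) tt => t' _.
  by rewrite Q2 addr_ge0 ?sqr_ge0.
move/eqP; rewrite Q2 paddr_eq0 ?sqr_ge0// !sqrf_eq0.
by move=> /andP[/eqP -> /eqP ->].
Qed.

(** One reflection moves the front of the zero set from a to the midpoint of a
    and L; the iterated midpoints converge to L. *)
Lemma strip_vanishing (a : R) :
  (forall s t, s < a -> t1 <= t <= t2 -> u (s, t) = 0 /\ w (s, t) = 0) ->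
  forall s t, s < L -> t1 <= t <= t2 -> u (s, t) = 0 /\ w (s, t) = 0.
Proof.
move=> zero s t sL tt.
have [sa|aS] := ltP s a; first exact: zero.
have La : 0 < L - a by lra.
have zn n : forall s t, s < L - (L - a) / 2 ^+ n -> t1 <= t <= t2 ->
    u (s, t) = 0 /\ w (s, t) = 0.
  elim: n => [|n ih]; first by rewrite expr0 divr1 subKr.
  move=> {tt aS} c {}t; set a' := L - (L - a) / 2 ^+ n in ih.
  have -> : L - (L - a) / 2 ^+ n.+1 = (a' + L) / 2.
    by rewrite /a' exprS; field.
  move=> cL tt; have [ca|ac] := ltP c a'; first exact: ih.
  (* any left end strictly between 2 * c - L and a' would do *)
  apply: (@strip_reflection ((a' + 2 * c - L) / 2) c) => //; [lra|lra|].
  by move=> t' tt'; apply: ih => //; lra.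
have e0 : 0 < (L - s) / (L - a) by rewrite divr_gt0// subr_gt0.
have [n _ /(_ n (leqnn n)) /= hn] := near_infty_natSinv_expn_lt (PosNum e0).
apply: (zn n) => //.
move: hn; rewrite ltr_pdivlMr// mulrC div1r; lra.
Qed.

End Strip.

Section Disc.
Variable R : realType.
Implicit Types (u w : R * R -> R) (p q : R * R).

Lemma cauchy_riemann_comp u w (x y : R * R -> R) p x' y' :
  cauchy_riemann u w (x p, y p) ->
  has_grad x p x' (- y') -> has_grad y p y' x' ->
  cauchy_riemann (fun q => u (x q, y q)) (fun q => w (x q, y q)) p.
Proof.
move=> [a [b [hu hw]]] hx hy.
exists (a * x' + b * y'), (a * - y' + b * x').
split; first exact: has_grad_comp.
by apply: has_gradW (has_grad_comp hw hx hy) _ _; ring.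
Qed.

Lemma polar_coordinates (x y : R) : 0 < x ^+ 2 + y ^+ 2 ->
  exists s t, [/\ - pi <= t <= pi, x = expR s * cos t, y = expR s * sin t
    & expR s ^+ 2 = x ^+ 2 + y ^+ 2].
Proof.
set m2 := x ^+ 2 + y ^+ 2 => m20.
pose m := Num.sqrt m2.
have m0 : 0 < m by rewrite sqrtr_gt0.
have mE : m ^+ 2 = m2 by rewrite sqr_sqrtr// ltW.
have xm : (x / m) ^+ 2 <= 1.
  by rewrite expr_div_n mE ler_pdivrMr// mul1r lerDl sqr_ge0.
have xmI : -1 <= x / m <= 1.
  by rewrite -ler_norml -(@expr_le1 _ 2)// real_normK ?num_real.
have em : expR (ln m) = m by rewrite lnK.
have sinE : m * sin (acos (x / m)) = `|y|.
  rewrite sin_acos// -[X in X * _](ger0_norm (ltW m0)) -sqrtr_sqr.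
  rewrite -sqrtrM ?sqr_ge0//.
  rewrite mulrBr mulr1 -exprMn mulrC divfK ?gt_eqF// mE.
  by rewrite /m2 addrC addKr sqrtr_sqr.
have cosE : m * cos (acos (x / m)) = x.
  by rewrite acosK ?in_itv// mulrC divfK// gt_eqF.
have t0 := acos_ge0 xmI; have tpi := acos_lepi xmI.
have pi0 := pi_ge0 R.
have [y0|y0] := leP 0 y.
  exists (ln m), (acos (x / m)); rewrite em cosE sinE ger0_norm//; split=> //.
  by rewrite tpi andbT; lra.
exists (ln m), (- acos (x / m)).
rewrite em cosN sinN cosE mulrN sinE ltr0_norm// opprK.
by split=> //; apply/andP; split; lra.
Qed.

Definition disc p (r : R) q := (q.1 - p.1) ^+ 2 + (q.2 - p.2) ^+ 2 < r ^+ 2.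

(** Composed with z |-> p + exp z, the functions become 2 i pi-periodic on the
    half-plane Re z < ln rho and vanish for Re z < ln r. *)
Lemma disc_vanishing u w p (r rho : R) : 0 < r -> 0 < rho ->
  (forall q, disc p rho q -> cauchy_riemann u w q) ->
  (forall q, disc p r q -> u q = 0 /\ w q = 0) ->
  forall q, disc p rho q -> u q = 0 /\ w q = 0.
Proof.
move=> r0 rho0 holo zero q qrho.
have [q0|qp] := leP ((q.1 - p.1) ^+ 2 + (q.2 - p.2) ^+ 2) 0.
  by apply: zero; apply: le_lt_trans q0 _; rewrite exprn_gt0.
pose X (z : R * R) := p.1 + expR z.1 * cos z.2.
pose Y (z : R * R) := p.2 + expR z.1 * sin z.2.
have XYdisc z rad : 0 < rad -> z.1 < ln rad -> disc p rad (X z, Y z).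
  move=> rad0 zr; rewrite /disc/= /X /Y.
  rewrite [_ + _ - _]addrC addKr [p.2 + _ - _]addrC addKr.
  rewrite !exprMn -mulrDr cos2Dsin2 mulr1 ltrXn2r// ?nnegrE ?expR_ge0 ?ltW//.
  by rewrite -[ltRHS]lnK// ltr_expR.
have := @strip_vanishing R (fun z => u (X z, Y z)) (fun z => w (X z, Y z))
  (ln rho) (- pi) pi _ _ _ (ln r).
have [s [t [tt Xt Yt st]]] := polar_coordinates qp.
have qE : q = (X (s, t), Y (s, t)).
  by rewrite /X /Y/= -Xt -Yt !subrKC -surjective_pairing.
move=> strip; rewrite qE; apply: strip => //.
- by rewrite gtrN ?pi_gt0.
- move=> z zL; have hc := holo _ (XYdisc z rho rho0 zL).
  have he := has_grad_fst_comp (is_derive_expR z.1).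
  have hcos := has_grad_snd_comp (is_derive_cos z.2).
  have hsin := has_grad_snd_comp (is_derive_sin z.2).
  apply: (cauchy_riemann_comp hc).
    apply: has_gradW (has_gradD (has_grad_cst p.1 z) (has_gradM he hcos)) _ _.
      by rewrite mulr0 !add0r addr0.
    by rewrite mul0r !add0r mulrN.
  apply: has_gradW (has_gradD (has_grad_cst p.2 z) (has_gradM he hsin)) _ _.
    by rewrite mulr0 !add0r addr0.
  by rewrite mul0r !add0r.
- by move=> s'; rewrite /X /Y/= cosN sinN sinpi oppr0.
- by move=> s' t' s'r _; apply: zero; apply: XYdisc.
rewrite -ltr_expR lnK// -(@ltr_pXn2r _ 2)// ?nnegrE ?expR_ge0 ?ltW//.
by rewrite st.
Qed.

End Disc.

(** * The identity principle *)

Section Identity.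
Variable R : realType.
Implicit Types (u w : R * R -> R) (p q : R * R) (U : set (R * R)).

(** The interior of the zero set is closed in U: a point of U in its closure
    lies in a disc contained in U whose centre is in that interior. *)
Lemma identity_principle u w U : open U -> connected U ->
  (forall q, U q -> cauchy_riemann u w q) ->
  (exists2 p, U p & \forall q \near p, u q = 0 /\ w q = 0) ->
  forall q, U q -> u q = 0 /\ w q = 0.
Proof.
move=> oU cU holo [p0 Up0 zp0].
pose B : set (R * R) := U `&` [set q | \forall z \near q, u z = 0 /\ w z = 0].
suff BU : B = U by move=> q; rewrite -BU => -[_ /nbhs_singleton].
apply: cU; first by exists p0.
  exists B; last by rewrite /B setIA setIid.
  apply: openI => //.
  rewrite openE => q /=; exact: nbhs_interior.
exists (closure B); first exact: closed_closure.
apply/seteqP; split=> [q Bq|p [Up clBp]].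
  by split; [case: Bq|exact: subset_closure].
split=> //.
(* z0 is taken within d / 4 of p in each coordinate: the disc of radius d / 2
   around z0 stays in U, and it contains a neighbourhood of p *)
have /near_box[d d0 dU] : \forall q \near p, U q by exact: open_nbhs_nbhs.
pose e := d / 4.
have e0 : 0 < e by rewrite divr_gt0.
have [z0 [[Uz0 /near_box[r r0 zr]] /= [z1 z2]]] :
    B `&` [set q | `|q.1 - p.1| < e /\ `|q.2 - p.2| < e] !=set0.
  by apply: clBp; apply/near_box; exists e.
have sq_lt (x y : R) : 0 < y -> x ^+ 2 < y ^+ 2 -> `|x| < y.
  by move=> y0; rewrite -[x ^+ 2]real_normK ?num_real// ltr_pXn2r// nnegrE ltW.
have vanish := @disc_vanishing R u w z0 r (2 * e) r0 _ _ _.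
apply/near_box; exists (e / 4); first by rewrite divr_gt0.
move=> q q1 q2; apply: vanish.
- by rewrite mulr_gt0.
- move=> z; rewrite /disc => zd; have := sqr_ge0 (z.1 - z0.1).
  have := sqr_ge0 (z.2 - z0.2) => s2 s1.
  have /sq_lt zz1 : (z.1 - z0.1) ^+ 2 < (2 * e) ^+ 2 by lra.
  have /sq_lt zz2 : (z.2 - z0.2) ^+ 2 < (2 * e) ^+ 2 by lra.
  have e20 : 0 < 2 * e by lra.
  apply: holo; apply: dU.
    have := ler_normD (z.1 - z0.1) (z0.1 - p.1); rewrite addrA subrK.
    by have := zz1 e20; rewrite /e in z1 *; lra.
  have := ler_normD (z.2 - z0.2) (z0.2 - p.2); rewrite addrA subrK.
  by have := zz2 e20; rewrite /e in z2 *; lra.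
- move=> z; rewrite /disc => zd; have := sqr_ge0 (z.1 - z0.1).
  have := sqr_ge0 (z.2 - z0.2) => s2 s1.
  have /sq_lt zz1 : (z.1 - z0.1) ^+ 2 < r ^+ 2 by lra.
  have /sq_lt zz2 : (z.2 - z0.2) ^+ 2 < r ^+ 2 by lra.
  by apply: zr; [exact: zz1|exact: zz2].
rewrite /disc.
have b1 : `|q.1 - z0.1| < e + e / 4.
  by have := ler_normB (q.1 - p.1) (z0.1 - p.1); rewrite opprB addrA subrK; lra.
have b2 : `|q.2 - z0.2| < e + e / 4.
  by have := ler_normB (q.2 - p.2) (z0.2 - p.2); rewrite opprB addrA subrK; lra.
have sq_le (x : R) : `|x| < e + e / 4 -> x ^+ 2 < (e + e / 4) ^+ 2.
  by move=> xe; rewrite -[x ^+ 2]real_normK ?num_real// ltrXn2r.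
have := sq_le _ b1; have := sq_le _ b2; have : 0 < e ^+ 2 by rewrite exprn_gt0.
rewrite (_ : (e + e / 4) ^+ 2 = 25 / 16 * e ^+ 2); last by field.
rewrite (_ : (2 * e) ^+ 2 = 4 * e ^+ 2); last by ring.
lra.
Qed.

End Identity.

(** * Holomorphic functions vanishing on the real axis *)

Section RealAxis.
Variable R : realType.
Implicit Types (u w : R * R -> R) (p q : R * R) (U : set (R * R)).

(** The sign of s selects the half-plane on which u is kept, so that the two
    half-planes are treated at once. *)
Definition half_cut (s : R) u q := if 0 < s * q.2 then u q else 0.

Let sign_near (s y z : R) : s != 0 -> `|z - y| < `|y| ->
  (0 < s * z) = (0 < s * y).
Proof.
move=> s0 zy; have : `|s * z - s * y| < `|s * y|.
  by rewrite -mulrBr !normrM ltr_pM2l ?normr_gt0.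
rewrite ltr_norml; have [sy|sy] := ltP 0 (s * y).
  by rewrite gtr0_norm// => /andP[? ?]; lra.
by rewrite ler0_norm// => /andP[? ?]; apply/negbTE; rewrite -leNgt; lra.
Qed.

Lemma has_grad_axis0 u p a b : (\forall q \near p, q.2 = p.2 -> u q = 0) ->
  has_grad u p a b -> a = 0.
Proof.
move=> /near_box[d1 d10 u0] hu; apply/eqP/negPn/negP => a0.
have e0 : 0 < `|a| / 2 by rewrite divr_gt0// normr_gt0.
have [d2 d20 H] := has_grad_box hu e0.
pose d := Num.min d1 d2 / 2.
have d0 : 0 < d by rewrite divr_gt0// lt_min d10.
have : d + d <= Num.min d1 d2 by rewrite /d; lra.
rewrite le_min => /andP[dd1 dd2].
have up : u p = 0 by apply: u0; rewrite ?subrr ?normr0.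
have dE : p.1 + d - p.1 = d by ring.
have uq : u (p.1 + d, p.2) = 0.
  by apply: u0; rewrite //= ?dE ?subrr ?normr0// gtr0_norm//; lra.
have := H (p.1 + d, p.2).
rewrite /= uq up dE !subrr normr0 mulr0 !addr0 sub0r normrN (gtr0_norm d0).
rewrite [`|a * d|]normrM (gtr0_norm d0) ler_pM2r// => le.
by have := le ltac:(lra) d20; lra.
Qed.

Lemma half_cut_axis s u p : p.2 = 0 -> u p = 0 -> has_grad u p 0 0 ->
  has_grad (half_cut s u) p 0 0.
Proof.
move=> p0 up /has_grad_expandP H; apply/has_grad_expandP => e e0.
apply: filterS (H e e0) => q; rewrite /half_cut p0 mulr0 ltxx up.
case: ifPn => // _ le; apply: le_trans le.
by rewrite !mul0r !addr0 !subr0 normr0.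
Qed.

(** On the axis, u and w are 0 along the x-direction, so their x-derivatives
    are 0 and the Cauchy-Riemann equations make both gradients 0. Then cutting
    off one side of the axis keeps them differentiable with gradient 0. *)
Lemma half_cut_holo s u w U : s != 0 -> open U ->
  (forall q, U q -> cauchy_riemann u w q) ->
  (forall q, U q -> q.2 = 0 -> u q = 0 /\ w q = 0) ->
  forall q, U q -> cauchy_riemann (half_cut s u) (half_cut s w) q.
Proof.
move=> s0 oU holo axis0 p Up; have [a [b [hu hw]]] := holo p Up.
have [p0|p0] := eqVneq p.2 0.
  have [up wp] := axis0 p Up p0.
  have near_axis : \forall q \near p, q.2 = p.2 -> u q = 0 /\ w q = 0.
    apply: filterS (open_nbhs_nbhs (conj oU Up)) => q Uq.
    by rewrite p0; exact: axis0.
  have a0 : a = 0.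
    by apply: has_grad_axis0 hu; apply: filterS near_axis => q /[apply] -[].
  have b0 : - b = 0.
    by apply: has_grad_axis0 hw; apply: filterS near_axis => q /[apply] -[].
  exists 0, 0; rewrite oppr0; move: hu hw; rewrite b0 a0.
  rewrite -(opprK b) b0 oppr0 => hu hw.
  by split; apply: half_cut_axis.
have cut_near (f : R * R -> R) : \forall q \near p,
    half_cut s f q = if 0 < s * p.2 then f q else 0.
  apply/near_box; exists `|p.2|; first by rewrite normr_gt0.
  by move=> q _ q2; rewrite /half_cut (sign_near s0 q2).
case: (boolP (0 < s * p.2)) cut_near => sp cut_near.
  exists a, b; split.
    by apply: has_grad_near hu; apply: filterS (cut_near u) => q.
  by apply: has_grad_near hw; apply: filterS (cut_near w) => q.
exists 0, 0; rewrite oppr0; split.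
  by apply: has_grad_near (has_grad_cst 0 p); apply: filterS (cut_near u) => q.
by apply: has_grad_near (has_grad_cst 0 p); apply: filterS (cut_near w) => q.
Qed.

(** For q off the axis, keep the functions on the side of q only: the result is
    holomorphic on U and 0 on an open set on the other side of the axis, near
    the given real point, so it is 0 at q by the identity principle. *)
Lemma real_axis_vanishing u w U : open U -> connected U ->
  (forall q, U q -> cauchy_riemann u w q) ->
  (exists2 p, U p & p.2 = 0) ->
  (forall q, U q -> q.2 = 0 -> u q = 0 /\ w q = 0) ->
  forall q, U q -> u q = 0 /\ w q = 0.
Proof.
move=> oU cU holo [p Up p0] axis0 q Uq.
have [q0|q0] := eqVneq q.2 0; first exact: axis0.
have /near_box[d d0 dU] := open_nbhs_nbhs (conj oU Up).
(* a point of U on the other side of the axis from q *)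
pose q' := (p.1, - (q.2 / `|q.2|) * (d / 2)).
have nq : `|q.2| != 0 by rewrite normr_eq0.
have Uq' : U q'.
  apply: dU; rewrite /q'/= ?subrr ?normr0//.
  rewrite p0 subr0 normrM normrN normrM normfV normr_id divff// mul1r.
  by rewrite gtr0_norm ?divr_gt0//; lra.
have [//|] := @identity_principle R _ _ U oU cU
  (half_cut_holo q0 oU holo axis0) _ q Uq.
  exists q' => //.
  have q'2 : q.2 * q'.2 < 0.
    have -> : q.2 * q'.2 = - (q.2 ^+ 2 / `|q.2| * (d / 2)).
      by rewrite /q'/=; ring.
    rewrite oppr_lt0 mulr_gt0 ?divr_gt0 ?normr_gt0//.
    by rewrite exprn_even_gt0.
  apply/near_box; exists `|q'.2|.
    by rewrite normr_gt0; apply: contraTneq q'2 => ->; rewrite mulr0 ltxx.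
  move=> z _ z2; rewrite /half_cut (sign_near q0 z2).
  by rewrite ltNge (ltW q'2).
by rewrite /half_cut -expr2 exprn_even_gt0// q0.
Qed.

End RealAxis.

(** * Quaternion-valued functions through real functionals *)

Section Quaternion.
Variable R : realType.
Implicit Types (q r I J e : quat R) (F G : R * R -> quat R) (p : R * R).

Lemma quat_normE q :
  `|q| = Num.sqrt (qre q ^+ 2 + qi q ^+ 2 + qj q ^+ 2 + qk q ^+ 2).
Proof. by []. Qed.

Lemma quat_normM q r : `|q * r| = `|q| * `|r|.
Proof.
rewrite !quat_normE -sqrtrM ?addr_ge0 ?sqr_ge0//; congr Num.sqrt.
by case: q r => [? ? ? ?] [? ? ? ?] /=; ring.
Qed.

Lemma ler_norm_qre q : `|qre q| <= `|q|.
Proof.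
rewrite quat_normE -sqrtr_sqr ler_wsqrtr// -!addrA lerDl.
by rewrite !addr_ge0 ?sqr_ge0.
Qed.

Lemma imag_unit_sqr I : imag_unit I -> I * I = -1.
Proof.
move=> [] re0; rewrite quat_normE => nI.
have : (Num.sqrt (qre I ^+ 2 + qi I ^+ 2 + qj I ^+ 2 + qk I ^+ 2)) ^+ 2 = 1.
  by rewrite nI expr1n.
rewrite sqr_sqrtr ?addr_ge0 ?sqr_ge0//.
case: I re0 {nI} => a b c d /= -> n2.
have -> : (-1 : quat R) = Quat (-1) 0 0 0 by congr Quat; rewrite oppr0.
by congr Quat => /=; lra.
Qed.

(** These functionals separate points, and left multiplication by a quaternion
    only changes the parameter e, so a first-order equation with quaternionic
    coefficients becomes a relation between members of the family. *)
Definition re_mul e q := qre (e * q).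

Lemma re_mul_is_linear e : linear (re_mul e).
Proof.
move=> k [? ? ? ?] [? ? ? ?]; case: e => *.
by rewrite /re_mul/= /GRing.scale/=; ring.
Qed.

HB.instance Definition _ e := GRing.isLinear.Build R (quat R) R _ (re_mul e)
  (re_mul_is_linear e).

Lemma re_mulB e q r : re_mul e (q - r) = re_mul e q - re_mul e r.
Proof. exact: (linearB (re_mul e)). Qed.

Lemma re_mulD e q r : re_mul e (q + r) = re_mul e q + re_mul e r.
Proof. exact: (linearD (re_mul e)). Qed.

Lemma re_mulZ e (k : R) q : re_mul e (k *: q) = k * re_mul e q.
Proof. by rewrite /re_mul -scalerAr. Qed.

Lemma re_mul_continuous e : continuous (re_mul e).
Proof.
apply: bounded_linear_continuous; apply/linear_boundedP.
exists `|e|; split; first by rewrite num_real.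
move=> M eM q; apply: le_trans (ler_norm_qre _) _; rewrite quat_normM.
by rewrite ler_wpM2r// ltW.
Qed.

Lemma re_mul_eq0 q : (forall e, re_mul e q = 0) -> q = 0.
Proof.
(* for e the conjugate of q, Re (e q) is the square of the norm of q *)
move=> /(_ (Quat (qre q) (- qi q) (- qj q) (- qk q))).
case: q => a b c d; rewrite /re_mul/= => s0.
have : a ^+ 2 + b ^+ 2 + c ^+ 2 + d ^+ 2 = 0 by rewrite -s0; ring.
move=> n0; apply/eqP; rewrite -normr_eq0 quat_normE/= n0.
by rewrite sqrtr0.
Qed.

Definition quat_grad F p r r' := forall e,
  has_grad (re_mul e \o F) p (re_mul e r) (re_mul e r').

Lemma differentiable_quat_grad F p : differentiable F p ->
  quat_grad F p ('D_(1, 0) F p) ('D_(0, 1) F p).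
Proof.
move=> dF e; have hF := differentiableP dF.
have hL : is_diff (F p) (re_mul e) (re_mul e).
  apply: DiffDef; last exact: diff_lin (@re_mul_continuous e).
  exact: linear_differentiable (@re_mul_continuous e).
apply: is_diff_eq (is_diff_comp hF hL) _; apply/funext => h /=.
rewrite !deriveE//.
have {1}-> : h = h.1 *: (1, 0) + h.2 *: (0, 1).
  rewrite [LHS]surjective_pairing; congr pair => /=.
    by rewrite /GRing.scale/= mulr1 mulr0 addr0.
  by rewrite /GRing.scale/= mulr1 mulr0 add0r.
by rewrite !linearD !linearZ; congr (_ + _); exact: mulrC.
Qed.

Lemma quat_gradB F G p r r' s s' : quat_grad F p r r' -> quat_grad G p s s' ->
  quat_grad (fun z => F z - G z) p (r - s) (r' - s').
Proof.
move=> hF hG e; rewrite !re_mulB.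
by apply: eq_has_grad (has_gradB (hF e) (hG e)) => z /=; rewrite re_mulB.
Qed.

Lemma quat_gradD F G p r r' s s' : quat_grad F p r r' -> quat_grad G p s s' ->
  quat_grad (fun z => F z + G z) p (r + s) (r' + s').
Proof.
move=> hF hG e; rewrite !re_mulD.
by apply: eq_has_grad (has_gradD (hF e) (hG e)) => z /=; rewrite re_mulD.
Qed.

Lemma quat_gradMl a F p r r' : quat_grad F p r r' ->
  quat_grad (fun z => a * F z) p (a * r) (a * r').
Proof.
move=> hF e; rewrite /re_mul !mulrA.
apply: eq_has_grad (hF (e * a)) => z.
exact: (congr1 (@qre R) (esym (mulrA e a (F z)))).
Qed.

Lemma quat_gradZ (k : R) F p r r' : quat_grad F p r r' ->
  quat_grad (fun z => k *: F z) p (k *: r) (k *: r').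
Proof.
move=> /(quat_gradMl k%:A); rewrite !mulr_algl.
by move=> hF e; apply: eq_has_grad (hF e) => z /=; rewrite mulr_algl.
Qed.

Lemma quat_grad_conj F (x y : R) r r' : quat_grad F (x, - y) r r' ->
  quat_grad (fun z => F (z.1, - z.2)) (x, y) r (- r').
Proof.
move=> hF e; have := has_grad_comp (hF e) (has_grad_fst (x, y))
  (has_gradN (has_grad_snd (x, y))).
by rewrite oppr0 !mulr0 mulr1 mulrN1 addr0 add0r -(linearN (re_mul e)).
Qed.

Definition slice_holomorphic I F p := exists r r',
  quat_grad F p r r' /\ r + I * r' = 0.

(** The harmonic conjugate of Re (e F) is Re (e (- I F)), since - I F is the
    product of F with the inverse of I. *)
Lemma slice_holomorphic_cauchy_riemann I F p e : imag_unit I ->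
  slice_holomorphic I F p ->
  cauchy_riemann (re_mul e \o F) (re_mul (- (e * I)) \o F) p.
Proof.
move=> /imag_unit_sqr II [r [r' [hF /eqP]]]; rewrite addr_eq0 => /eqP rE.
exists (re_mul e r), (re_mul e r'); split; first exact: hF.
apply: has_gradW (hF (- (e * I))) _ _; rewrite /re_mul.
  by rewrite rE mulrNN -mulrA (mulrA I) II mulN1r mulrN.
by rewrite rE mulrN mulNr mulrA.
Qed.

End Quaternion.

(** * The representation formula *)

Section Slices.
Variable R : realType.
Implicit Types (q r I J e : quat R) (Omega : set (quat R)).
Implicit Types (f : quat R -> quat R).

Definition slice_chart I Omega : set (R * R) :=
  [set p | Omega (slice_pt I p.1 p.2)].

Lemma slice_pt_continuous I : continuous (fun p : R * R => slice_pt I p.1 p.2).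
Proof.
move=> p.
have c1 : z.1 *: (1 : quat R) @[z --> p] --> p.1 *: (1 : quat R).
  by apply: cvgZr_tmp; exact: cvg_fst.
have c2 : z.2 *: I @[z --> p] --> p.2 *: I by apply: cvgZr_tmp; exact: cvg_snd.
exact: (cvgD c1 c2).
Qed.

Lemma slice_chart_open I Omega : open Omega -> open (slice_chart I Omega).
Proof.
by move=> oO; apply: (open_comp _ oO) => p _; exact: slice_pt_continuous.
Qed.

Lemma slice_coord I x y : imag_unit I ->
  re_mul 1 (slice_pt I x y) = x /\ re_mul (- I) (slice_pt I x y) = y.
Proof.
move=> iI; have II := imag_unit_sqr iI; have [re0 _] := iI.
have re11 : re_mul 1 1 = 1 :> R by rewrite /re_mul mulr1.
have re1I : re_mul 1 I = 0 by rewrite /re_mul mul1r.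
have reI1 : re_mul (- I) 1 = 0 by rewrite /re_mul mulr1/= re0 oppr0.
have reII : re_mul (- I) I = 1 by rewrite /re_mul mulNr II opprK.
rewrite /slice_pt !re_mulD !re_mulZ re11 re1I reI1 reII.
by rewrite !mulr0 !mulr1 addr0 add0r.
Qed.

(** The chart is the image of the slice of Omega under the coordinate map
    q |-> (Re q, Re (- I q)), which is continuous on all quaternions and hence
    for the relative topology of the slice. *)
Lemma slice_chart_connected I Omega : imag_unit I ->
  connected (Omega `&` slice I : set (subspace (slice I))) ->
  connected (slice_chart I Omega).
Proof.
move=> iI cO.
pose c q := (re_mul 1 q, re_mul (- I) q).
have cc : continuous c.
  move=> q; have := cvg_pair (@re_mul_continuous R 1 q)
    (@re_mul_continuous R (- I) q).
  exact.
have -> : slice_chart I Omega = c @` (Omega `&` slice I).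
  apply/seteqP; split=> [[x y] Op|_ [q [Oq [x [y qE]]] <-]].
    have [h1 h2] := slice_coord x y iI.
    exists (slice_pt I x y); last by rewrite /c h1 h2.
    by split=> //; exists x, y.
  move: Oq; rewrite qE /slice_chart /c/=.
  by have [-> ->] := slice_coord x y iI.
apply: (connected_continuous_connected cO).
by apply: continuous_subspaceT; exact: continuous_subspaceT.
Qed.

Lemma regular_slice_holomorphic f Omega I p : slice_regular Omega f ->
  imag_unit I -> slice_chart I Omega p ->
  slice_holomorphic I (slice_restr f I) p.
Proof.
case: p => x y reg iI Op; have [df cr] := reg I iI x y Op.
do 2 eexists; split; first exact: differentiable_quat_grad df.
have /(congr1 (GRing.scale 2)) := cr.
by rewrite scalerA divff// scale1r scaler0.
Qed.

(** The right-hand side of the formula as a function on the plane of I, F being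
    the restriction of f to the slice of J in real coordinates. *)
Definition representation I J (F : R * R -> quat R) (p : R * R) : quat R :=
  2^-1 *: (F p + F (p.1, - p.2)) + I * (2^-1 *: (J * (F (p.1, - p.2) - F p))).

(** Write Fx = - J Fy for the derivatives at (x, y) and Gx = - J Gy for those at
    (x, - y); reflecting y changes the sign of Gy. As J ^ 2 = -1, the
    x-derivative of the formula is A - I B and its y-derivative is B + I A, with
    A = J (- Gy - Fy) / 2 and B = (Fy - Gy) / 2. These satisfy the equation of
    the slice of I because I ^ 2 = -1. *)
Lemma representation_holomorphic I J (F : R * R -> quat R) p :
  imag_unit I -> imag_unit J ->
  slice_holomorphic J F p -> slice_holomorphic J F (p.1, - p.2) ->
  slice_holomorphic I (representation I J F) p.
Proof.
case: p => x y /imag_unit_sqr II /imag_unit_sqr JJ.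
move=> [Fx [Fy [hF /eqP]]]; rewrite addr_eq0 => /eqP FxE.
move=> [Gx [Gy [hG /eqP]]]; rewrite addr_eq0 => /eqP GxE.
have hG' := quat_grad_conj hG.
do 2 eexists; split.
  apply: quat_gradD; first exact: quat_gradZ (quat_gradD hF hG').
  apply/quat_gradMl/quat_gradZ/quat_gradMl; exact: quat_gradB hG' hF.
have -> : J * (Gx - Fx) = Gy - Fy.
  by rewrite FxE GxE mulrBr !mulrN !mulrA JJ !mulN1r !opprK.
have -> : Fx + Gx = J * (- Gy - Fy) by rewrite FxE GxE mulrDr !mulrN addrC.
set A := 2^-1 *: (J * _); rewrite -(opprB Fy) scalerN mulrN.
set B := 2^-1 *: (Fy - Gy).
rewrite mulrDr mulrA II mulN1r [A - _]addrC addrA -[_ + A + _]addrA.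
by rewrite [A + _]addrC addrA addNr add0r subrr.
Qed.

Lemma slice_holomorphicB I (F G : R * R -> quat R) p :
  slice_holomorphic I F p -> slice_holomorphic I G p ->
  slice_holomorphic I (fun z => F z - G z) p.
Proof.
move=> [r [r' [hF rE]]] [s [s' [hG sE]]]; exists (r - s), (r' - s').
by split; [exact: quat_gradB|rewrite mulrBr addrACA rE -opprD sE oppr0 addr0].
Qed.

Lemma imag_unitN J : imag_unit J -> imag_unit (- J).
Proof. by move=> [re0 nJ]; split; rewrite ?normrN//= re0 oppr0. Qed.

Lemma circular_chart Omega I J p : circular Omega -> imag_unit I ->
  imag_unit J -> slice_chart I Omega p ->
  slice_chart J Omega p /\ slice_chart J Omega (p.1, - p.2).
Proof.
move=> circ iI iJ Op; split; apply: (circ _ _ _ iI Op); first by exists J.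
exists (- J); first exact: imag_unitN.
by rewrite /slice_pt scalerN scaleNr.
Qed.

(** The difference of the two sides is holomorphic on the slice of I and
    vanishes on the real axis, which meets Omega; circularity of Omega is
    what makes the right-hand side holomorphic on the whole slice. *)
Lemma slice_representation f Omega I J p : slice_domain Omega ->
  circular Omega -> slice_regular Omega f -> imag_unit I -> imag_unit J ->
  slice_chart I Omega p ->
  slice_restr f I p = representation I J (slice_restr f J) p.
Proof.
move=> [[_ oO _] [q0 [Oq0 [x0 _ q0E]]] sl] circ reg iI iJ Op.
apply/eqP; rewrite -subr_eq0; apply/eqP/re_mul_eq0 => e.
pose g p := slice_restr f I p - representation I J (slice_restr f J) p.
rewrite -[LHS]/((re_mul e \o g) p).
have [_ _ cI] := sl I iI.
apply: (proj1 (@real_axis_vanishing R _ (re_mul (- (e * I)) \o g) _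
  (slice_chart_open oO) (slice_chart_connected iI cI) _ _ _ p Op)).
- move=> z Oz; apply: slice_holomorphic_cauchy_riemann => //.
  have [Oz1 Oz2] := circular_chart circ iI iJ Oz.
  apply: slice_holomorphicB; first exact: regular_slice_holomorphic reg iI Oz.
  apply: representation_holomorphic => //.
    exact: regular_slice_holomorphic reg iJ Oz1.
  exact: regular_slice_holomorphic reg iJ Oz2.
- exists (x0, 0) => //=.
  by rewrite /slice_chart /slice_pt/= scale0r addr0 q0E.
(* at a real point both x + y J and x - y J are x *)
move=> [x y] _ /= y0; suff g0 : g (x, y) = 0.
  by rewrite g0; split; exact: (linear0 (re_mul _)).
rewrite /g /representation /slice_restr /slice_pt/= y0 oppr0 !scale0r addr0.
rewrite subrr mulr0 scaler0 mulr0 addr0 -mulr2n -(scaler_nat 2 (f _)) scalerA.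
by rewrite mulVf// scale1r subrr.
Qed.

End Slices.

Theorem theorem1p4 (R : realType) (Omega : set (quat R))
    (f : quat R -> quat R)
    (Omega_sdomain : slice_domain Omega) (Omega_circular : circular Omega)
    (f_regular : slice_regular Omega f)
    (J : quat R) (J_unit : imag_unit J)
    (x y : R) (I : quat R) (I_unit : imag_unit I)
    (q_in : Omega (x%:A + y *: I)) :
  f (x%:A + y *: I) =
    2^-1 *: (f (x%:A + y *: J) + f (x%:A - y *: J))
    + I * (2^-1 *: (J * (f (x%:A - y *: J) - f (x%:A + y *: J)))).
Proof.
have := @slice_representation R f Omega I J (x, y) Omega_sdomain
  Omega_circular f_regular I_unit J_unit q_in.
by rewrite /representation /slice_restr /slice_pt/= scaleNr.
Qed.
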